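(* Let $n\ge 2$ and let $\mathbb U$ be a Euclidean space of dimension $n$ over $K$ with a fixed orthonormal basis $v_1,\dots,v_n$. The algebra $(\operatorname{Sym}_0(\mathbb U),\odot)$ is isomorphic to the incidence algebra of $G_2(n)$, $$(\operatorname{Sym}_0(\mathbb U),\odot)\ \cong\ \mathbb A^{\mathbf 1}(G_2(n)),$$ via the linear map sending $S_{ij}$ to $e_{ij}$.
   Context: $K$ is a formally real Pythagorean field. For $x,y\in\mathbb U$, $xy^T$ is the endomorphism $z\mapsto\langle y,z\rangle x$. $\operatorname{Sym}(\mathbb U)$ is the space of self-adjoint endomorphisms of $\mathbb U$, $S_{ij}=v_iv_j^T+v_jv_i^T$ for $i\ne j$, $\operatorname{Sym}_0(\mathbb U)=\operatorname{span}_K\{S_{ij}:i<j\}$ (self-adjoint endomorphisms whose matrices in the fixed basis have zero diagonal), and $\pi:\operatorname{Sym}(\mathbb U)\to\operatorname{Sym}_0(\mathbb U)$ is the projection along the diagonal, $\operatorname{span}_K\{v_iv_i^T\}$. The product $\odot$ on $\operatorname{Sym}_0(\mathbb U)$ is the projected Jordan product $X\odot Y=\pi(XY+YX)$. $\mathbb A^{\mathbf 1}(G_2(n))$ (the incidence algebra of $G_2(n)$, i.e. with trivial decoration) is the commutative (nonassociative) $K$-algebra with basis $\{e_{ij}:\{i,j\}\subseteq\{1,\dots,n\},\ i\neq j\}$ ($e_{ij}=e_{ji}$) and bilinear product $e_{ij}\circ e_{ik}=e_{jk}$ for distinct $i,j,k$, $e_{ij}\circ e_{ij}=0$, and $e_{ij}\circ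 e_{kl}=0$ for $\{i,j\}\cap\{k,l\}=\varnothing$. *)

(* Defs.v *)
From HB Require Import structures.
From mathcomp Require Import all_boot all_order all_algebra zify.
Set Implicit Arguments.
Unset Strict Implicit.
Unset Printing Implicit Defensive.
Import GRing.Theory.
Local Open Scope ring_scope.

Definition formally_real (K : fieldType) : Prop :=
  forall s : seq K, \sum_(x <- s) x ^+ 2 <> -1.

Definition pythagorean (K : fieldType) : Prop :=
  forall x y : K, exists z, x ^+ 2 + y ^+ 2 = z ^+ 2.

(* A Euclidean space over a formally real Pythagorean field K is a
   finite-dimensional space with a symmetric bilinear form for which every
   nonzero x has a nonzero length in K, i.e. <x, x> is a nonzero square.  No
   ordering of K is chosen: K may have several, and the nonzero squares (which
   are the nonzero sums of squares) are the elements positive in all of them.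
   Having an orthonormal basis is an equivalent condition over such a K. *)
Definition euclidean (K : fieldType) (U : vectType K) (form : {symmetric U})
  : Prop :=
  forall x : U, x != 0 -> exists2 c : K, c != 0 & form x x = c ^+ 2.

Section SelfAdjoint.

Variables (K : fieldType) (U : vectType K) (form : {symmetric U}).
Implicit Types (X Y : 'End(U)) (x y z : U).

Lemma formC x y : form x y = form y x.
Proof. by rewrite hermC /= expr0 mul1r. Qed.

Lemma formZl y a u : form (a *: u) y = a * form u y.
Proof. by rewrite linearZl_LR. Qed.

Lemma formZr y a u : form y (a *: u) = a * form y u.
Proof. by rewrite formC formZl formC. Qed.

Lemma formPl y a u w : form (a *: u + w) y = a * form u y + form w y.
Proof. by rewrite linearDl /= formZl. Qed.

Lemma formPr y a u w : form y (a *: u + w) = a * form y u + form y w.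
Proof. by rewrite formC formPl !(formC _ y). Qed.

Definition outer_fun x y z : U := form y z *: x.

Fact outer_is_linear x y : linear (outer_fun x y).
Proof. by move=> a u w; rewrite /outer_fun formPr scalerDl scalerA. Qed.
HB.instance Definition _ x y :=
  GRing.isLinear.Build K U U _ (outer_fun x y) (outer_is_linear x y).

(* x y^T *)
Definition outer x y : 'End(U) := linfun (outer_fun x y).

Lemma outerE x y z : outer x y z = form y z *: x.
Proof. by rewrite lfunE. Qed.

Definition defect_fun X x y : K^o := form (X x) y - form x (X y).

Fact defect_is_linear X x : linear (defect_fun X x).
Proof.
move=> a u w; rewrite /defect_fun (linearP X) !formPr opprD addrACA.
by rewrite -mulrBr.
Qed.
HB.instance Definition _ X x :=
  GRing.isLinear.Build K U K^o _ (defect_fun X x) (defect_is_linear X x).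

Definition defect1 X x : 'Hom(U, K^o) := linfun (defect_fun X x).

Fact defect1_is_linear X : linear (defect1 X).
Proof.
move=> a u w; apply/lfunP=> y; rewrite add_lfunE scale_lfunE !lfunE /=.
rewrite /defect_fun (linearP X) !formPl opprD addrACA.
by rewrite -mulrBr.
Qed.
HB.instance Definition _ X :=
  GRing.isLinear.Build K U 'Hom(U, K^o) _ (defect1 X) (defect1_is_linear X).

Definition defect X : 'Hom(U, 'Hom(U, K^o)) := linfun (defect1 X).

Fact defect_linear : linear defect.
Proof.
move=> a X Y; apply/lfunP=> x; apply/lfunP=> y.
rewrite !(add_lfunE, scale_lfunE).
rewrite /defect !lfunE /=.
rewrite /defect_fun !add_lfunE !scale_lfunE formPl formPr opprD addrACA.
by rewrite -mulrBr.
Qed.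
HB.instance Definition _ :=
  GRing.isLinear.Build K 'End(U) 'Hom(U, 'Hom(U, K^o)) _ defect defect_linear.

(* The kernel of X |-> ((x, y) |-> <X x, y> - <x, X y>); see memSym. *)
Definition Sym : {vspace 'End(U)} := lker (linfun defect).

Lemma memSym X :
  X \in Sym <-> forall x y, form (X x) y = form x (X y).
Proof.
rewrite memv_ker lfunE /=; split=> [/eqP/lfunP X0 x y | XS].
  have /lfunP/(_ y) := X0 x; rewrite !lfunE /=.
  by move/eqP; rewrite subr_eq0 => /eqP.
apply/eqP/lfunP=> x; apply/lfunP=> y; rewrite !lfunE /=.
by rewrite /defect_fun XS subrr.
Qed.

Lemma jordan_Sym X Y :
  X \in Sym -> Y \in Sym -> ((X \o Y) + (Y \o X))%VF \in Sym.
Proof.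
move=> /memSym XS /memSym YS; apply/memSym=> x y.
by rewrite !add_lfunE !comp_lfunE linearDl linearDr /= XS !YS XS addrC.
Qed.

End SelfAdjoint.

Section SymAlgebra.

Variables (K : fieldType) (U : vectType K) (form : {symmetric U}).
Variables (n : nat) (v : n.-tuple U).
Local Notation "''v_' i" := (tnth v i) (at level 8, i at level 2).
Local Notation Sym := (Sym form).
Local Notation outer := (outer form).

Definition Sij (i j : 'I_n) : 'End(U) := outer 'v_i 'v_j + outer 'v_j 'v_i.

Definition Sym0 : {vspace 'End(U)} :=
  <<[seq Sij p.1 p.2 | p in [pred p : 'I_n * 'I_n | (p.1 < p.2)%N]]>>%VS.

Definition Diag : {vspace 'End(U)} :=
  <<[seq outer 'v_i 'v_i | i : 'I_n]>>%VS.

Lemma SijC i j : Sij i j = Sij j i.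
Proof. exact: addrC. Qed.

Lemma Sij_Sym i j : Sij i j \in Sym.
Proof.
apply/memSym=> x y; rewrite !add_lfunE !outerE linearDl linearDr /=.
rewrite !(formZl, formZr) !(formC _ x).
by rewrite addrC ![form _ y * _]mulrC.
Qed.

Lemma Sym0_sub : (Sym0 <= Sym)%VS.
Proof. by apply/span_subvP=> _ /imageP[p _ ->]; apply: Sij_Sym. Qed.

Lemma Sij_Sym0 i j : i != j -> Sij i j \in Sym0.
Proof.
wlog ltij : i j / (i < j)%N => [IH ne_ij|_].
  have [lt|gt|/val_inj eq] := ltngtP i j; first exact: IH.
    by rewrite SijC; apply: IH; rewrite 1?eq_sym.
  by rewrite eq eqxx in ne_ij.
by apply/memv_span/imageP; exists (i, j).
Qed.

(* daddv_pi Sym0 Diag is the projection onto Sym0 along Diag on Sym0 + Diag,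
   which is a direct sum equal to Sym when v is an orthonormal basis: see
   Sym0_Diag_direct and Sym_decomposition. *)
Definition proj_diag : 'Hom(subvs_of Sym, subvs_of Sym0) :=
  linfun (vsproj Sym0 \o daddv_pi Sym0 Diag \o vsval).

Fact jordan_Sym0 (X Y : subvs_of Sym0) :
  ((vsval X \o vsval Y) + (vsval Y \o vsval X))%VF \in Sym.
Proof. by apply: jordan_Sym; apply: (subvP Sym0_sub); apply: subvsP. Qed.

Definition odot (X Y : subvs_of Sym0) : subvs_of Sym0 :=
  proj_diag (Subvs (jordan_Sym0 X Y)).

Lemma val_proj_diag X : vsval (proj_diag X) = daddv_pi Sym0 Diag (vsval X).
Proof. by rewrite lfunE /= vsprojK ?memv_pi. Qed.

Definition Sij0 (i j : 'I_n) (ne_ij : i != j) : subvs_of Sym0 :=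
  Subvs (Sij_Sym0 ne_ij).

Hypotheses (v_basis : basis_of fullv v) (v_on : orthonormal form v).

Lemma form_v i j : form 'v_i 'v_j = (i == j)%:R.
Proof.
have /andP[/all_tnthP v1 vo] := v_on.
have [-> | ne_ij] := eqVneq i j; first exact/eqP/v1.
wlog ltij : i j ne_ij / (i < j)%N => [IH|].
  have [lt|gt|/val_inj eq] := ltngtP i j; first exact: IH.
    by rewrite formC IH // eq_sym.
  by rewrite eq eqxx in ne_ij.
have ortho (s : seq U) k l : pair_ortho_rec form s ->
    (k < l < size s)%N -> form s`_k s`_l = 0.
  elim: s k l => [|x s IHs] [|k] [|l] //=; rewrite ?andbF // => /andP[]; rewrite ?andbT.
    by move=> /allP xs _ lt_ls; apply/eqP/xs/mem_nth.
  by move=> _ /IHs; apply.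
by rewrite !(tnth_nth 0) ortho // ltij size_tuple /=.
Qed.

Lemma v_expand x : x = \sum_i form 'v_i x *: 'v_i.
Proof.
rewrite [x in LHS](coord_basis v_basis (memvf x)).
apply: eq_bigr => i _; congr (_ *: _); last by rewrite (tnth_nth 0).
rewrite [x in RHS](coord_basis v_basis (memvf x)) linear_sumr.
rewrite (bigD1 i) //= big1 ?addr0 => [|j ne_ji].
  by rewrite (formZr form) -tnth_nth form_v eqxx mulr1.
by rewrite (formZr form) -tnth_nth form_v eq_sym (negPf ne_ji) mulr0.
Qed.

Lemma End_expand (X : 'End(U)) :
  X = \sum_i \sum_j form 'v_i (X 'v_j) *: outer 'v_i 'v_j.
Proof.
apply/lfunP=> x; rewrite [x in LHS]v_expand linear_sum exchange_big /=.
rewrite sum_lfunE; apply: eq_bigr => j _.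
rewrite linearZ /= [X _ in LHS]v_expand scaler_sumr sum_lfunE.
apply: eq_bigr => i _.
by rewrite scale_lfunE outerE !scalerA [in LHS]mulrC.
Qed.

Lemma Sym0_diag0 X i : X \in Sym0 -> form 'v_i (X 'v_i) = 0.
Proof.
move=> /coord_span ->; rewrite sum_lfunE linear_sumr big1 // => k _.
rewrite scale_lfunE linearZr_LR /=; set s := image_tuple _ _.
have /imageP[[a b] /= ltab ->] : s`_k \in tval s by rewrite -tnth_nth mem_tnth.
rewrite add_lfunE !outerE linearDr /= !(formZr form) !form_v.
have ab : (a == b) = false by rewrite -val_eqE (ltn_eqF ltab).
by rewrite !(eq_sym i) (eq_sym b); case: (eqVneq a i) => [<-|_];
  rewrite ?ab !(mul0r, mulr0) ?addr0 ?mulr0.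
Qed.

Lemma Diag_off0 X i j : X \in Diag -> i != j -> form 'v_i (X 'v_j) = 0.
Proof.
move=> /coord_span ->; rewrite sum_lfunE linear_sumr => ne_ij.
rewrite big1 // => k _.
rewrite scale_lfunE linearZr_LR /=; set s := image_tuple _ _.
have /imageP[a _ ->] : s`_k \in tval s by rewrite -tnth_nth mem_tnth.
rewrite outerE (formZr form) !form_v.
by case: (eqVneq a j) => [->|]; rewrite ?(negPf ne_ij) ?mul0r !mulr0.
Qed.

Lemma Sym0_Diag_direct : (Sym0 :&: Diag = 0)%VS.
Proof.
apply/eqP; rewrite -subv0; apply/subvP=> X; rewrite memv_cap memv0.
case/andP=> X0 XD; apply/eqP; rewrite [X]End_expand.
rewrite big1 // => i _; rewrite big1 // => j _.
have [->|ne_ij] := eqVneq i j; first by rewrite Sym0_diag0 // scale0r.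
by rewrite Diag_off0 // scale0r.
Qed.

Lemma Sym_decomposition : (Sym0 + Diag)%VS = Sym.
Proof.
apply/eqP; rewrite eqEsubv subv_add Sym0_sub /=; apply/andP; split.
  apply/span_subvP=> _ /imageP[i _ ->]; apply/memSym=> x y.
  by rewrite !outerE (formZl form) (formZr form) mulrC (formC _ x).
apply/subvP=> X XS; rewrite [X]End_expand.
have Xij i j : form 'v_i (X 'v_j) = form 'v_j (X 'v_i).
  by rewrite -(iffLR (memSym _ _) XS) formC.
rewrite pair_bigA (bigID [pred p : 'I_n * 'I_n | (p.1 < p.2)%N]) /=.
rewrite addrC (bigID [pred p : 'I_n * 'I_n | p.1 == p.2]) /= -addrA addrC.
apply: memv_add; last first.
  apply: memv_suml => -[i j] /= /andP[_ /eqP->]; apply/memvZ/memv_span.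
  by apply/imageP; exists j.
rewrite (reindex_inj (h := fun p : 'I_n * 'I_n => (p.2, p.1))) /=; last first.
  by move=> [a b] [c d] [-> ->].
rewrite (eq_bigl (fun p : 'I_n * 'I_n => p.1 < p.2)%N) => [|[i j] /=].
  rewrite -big_split /=; apply: memv_suml => -[i j] /= ltij.
  rewrite Xij -scalerDr addrC; apply/memvZ/memv_span.
  by apply/imageP; exists (i, j).
by rewrite -leqNgt -val_eqE /= (ltn_neqAle i j) andbC eq_sym.
Qed.

End SymAlgebra.

Section IncidenceAlgebra.

Variables (K : fieldType) (n : nat).

Definition edge : Type := {A : {set 'I_n} | #|A| == 2}.
HB.instance Definition _ := Finite.on edge.

(* The K-vector space of functions on the 2-subsets {i, j} of 'I_n, with the
   product inc_mul.  The lemmas below are the defining properties of the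
   incidence algebra. *)
Definition inc_alg : vectType K := {ffun edge -> K^o}.

(* The basis vector of {i, j} if i != j; junk value inc_e i i = 0. *)
Definition inc_e (i j : 'I_n) : inc_alg :=
  [ffun A : edge => (val A == [set i; j])%:R : K^o].

(* If A and B share exactly one point, their symmetric difference is the
   third side of the triangle they span. *)
Definition edge_mul (A B : edge) : inc_alg :=
  [ffun C : edge => ((#|val A :&: val B| == 1)
     && (val C == (val A :\: val B) :|: (val B :\: val A)))%:R : K^o].

Definition inc_mul (x y : inc_alg) : inc_alg :=
  \sum_A \sum_B ((x : {ffun edge -> K^o}) A * (y : {ffun edge -> K^o}) B)
    *: edge_mul A B.

Lemma inc_eC i j : inc_e i j = inc_e j i.
Proof. by rewrite /inc_e setUC. Qed.

Definition mk_edge (A : {set 'I_n}) (cA : #|A| == 2) : edge :=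
  exist (fun A : {set 'I_n} => #|A| == 2) A cA.

Lemma inc_mulC x y : inc_mul x y = inc_mul y x.
Proof.
rewrite /inc_mul exchange_big; apply: eq_bigr => B _; apply: eq_bigr => A _.
rewrite mulrC; congr (_ *: _).
by apply/ffunP=> C; rewrite !ffunE setIC setUC.
Qed.

Lemma inc_mulPl a x y z :
  inc_mul (a *: x + y) z = a *: inc_mul x z + inc_mul y z.
Proof.
rewrite /inc_mul scaler_sumr -big_split; apply: eq_bigr => A _ /=.
rewrite scaler_sumr -big_split; apply: eq_bigr => B _ /=.
by rewrite !ffunE mulrDl scalerDl scalerA mulrA.
Qed.

Lemma inc_mul_edge (A B : edge) i j k l :
  val A = [set i; j] -> val B = [set k; l] ->
  inc_mul (inc_e i j) (inc_e k l) = edge_mul A B.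
Proof.
move=> defA defB; rewrite /inc_mul (bigD1 A) //= (bigD1 B) //= !ffunE.
rewrite defA defB !eqxx mulr1 scale1r big1 => [|C neC]; last first.
  by rewrite !ffunE -defB (inj_eq val_inj) (negPf neC) mulr0 scale0r.
rewrite big1 ?addr0 // => C neC; rewrite big1 // => D _.
by rewrite !ffunE -defA (inj_eq val_inj) (negPf neC) mul0r scale0r.
Qed.

Lemma inc_mul_adj i j k : i != j -> i != k -> j != k ->
  inc_mul (inc_e i j) (inc_e i k) = inc_e j k.
Proof.
move=> ij ik jk.
have cA : #|[set i; j]| == 2 by rewrite cards2 ij.
have cB : #|[set i; k]| == 2 by rewrite cards2 ik.
rewrite (@inc_mul_edge (mk_edge cA) (mk_edge cB)) //.
apply/ffunP=> C; rewrite !ffunE /=.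
have -> : [set i; j] :&: [set i; k] = [set i].
  apply/setP=> x; rewrite !inE; case: (eqVneq x i) => //= _.
  by case: (eqVneq x j) => //= ->; rewrite (negPf jk).
rewrite cards1; congr (_ == _)%:R; apply/setP=> x; rewrite !inE.
case: (eqVneq x i) => [->|]; first by rewrite (negPf ij) (negPf ik).
case: (eqVneq x j) => [->|]; first by rewrite (negPf jk).
by rewrite andbF.
Qed.

Lemma inc_mul_same i j : i != j -> inc_mul (inc_e i j) (inc_e i j) = 0.
Proof.
move=> ij; have cA : #|[set i; j]| == 2 by rewrite cards2 ij.
rewrite (@inc_mul_edge (mk_edge cA) (mk_edge cA)) //.
by apply/ffunP=> C; rewrite !ffunE /= setIid (eqP cA).
Qed.

Lemma inc_mul_disj i j k l : i != j -> k != l ->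
  [disjoint [set i; j] & [set k; l]] ->
  inc_mul (inc_e i j) (inc_e k l) = 0.
Proof.
move=> ij kl dis.
have cA : #|[set i; j]| == 2 by rewrite cards2 ij.
have cB : #|[set k; l]| == 2 by rewrite cards2 kl.
rewrite (@inc_mul_edge (mk_edge cA) (mk_edge cB)) //.
by apply/ffunP=> C; rewrite !ffunE /= (disjoint_setI0 dis) cards0.
Qed.

Lemma inc_e_basis : basis_of fullv
  [seq inc_e p.1 p.2 | p in [pred p : 'I_n * 'I_n | (p.1 < p.2)%N]].
Proof.
pose d (A : edge) : inc_alg := [ffun B : edge => (B == A)%:R : K^o].
have d_inj : injective d.
  move=> A B /ffunP/(_ A); rewrite !ffunE eqxx.
  by case: eqP => // _ /eqP; rewrite oner_eq0.
have inc_d i j (cA : #|[set i; j]| == 2) : inc_e i j = d (mk_edge cA).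
  by apply/ffunP=> B; rewrite !ffunE.
have c2 (i j : 'I_n) : (i < j)%N -> #|[set i; j]| == 2.
  by move=> lt; rewrite cards2 -val_eqE /= (ltn_eqF lt).
have d_span : (<<[seq d A | A : edge]>> = fullv)%VS.
  apply/eqP; rewrite eqEsubv subvf; apply/subvP=> x _.
  have -> : x = \sum_A ((x : {ffun edge -> K^o}) A : K) *: d A.
    apply/ffunP=> B; rewrite sum_ffunE (bigD1 B) //= big1 ?addr0 => [|A neA].
      by rewrite !ffunE eqxx; rewrite /GRing.scale /= mulr1.
    by rewrite !ffunE eq_sym (negPf neA) scaler0.
  by apply: memv_suml => A _; apply/memvZ/memv_span/image_f.
have d_basis : basis_of fullv [seq d A | A : edge].
  rewrite basisEdim d_span subvv size_image /=.
  by rewrite dimvf /dim /= /dim /= muln1.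
rewrite (perm_basis (Y := [seq d A | A : edge])) //; apply: uniq_perm.
- rewrite map_inj_in_uniq ?enum_uniq // => -[a b] [c e].
  rewrite !mem_enum !inE /= => ltab ltce.
  rewrite (inc_d _ _ (c2 _ _ ltab)) (inc_d _ _ (c2 _ _ ltce)).
  move=> /d_inj [/setP eqs].
  have := eqs a; have := eqs b; have := eqs c; have := eqs e.
  rewrite !inE !eqxx ?orbT /= -!val_eqE /= => e1 e2 e3 e4.
  by congr pair; apply/val_inj => /=; lia.
- by rewrite map_inj_uniq ?enum_uniq.
move=> x; apply/imageP/imageP=> [[[i j] /= ltij ->]|[[A cA] _ ->]].
  by exists (mk_edge (c2 _ _ ltij)); last exact: inc_d.
have [i [j [ne_ij defA]]] := cards2P _ cA; move: cA; rewrite defA => cA.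
have [lt|gt|/val_inj eq] := ltngtP i j.
- by exists (i, j); rewrite //= (inc_d _ _ cA).
- by exists (j, i); rewrite //= inc_eC (inc_d _ _ cA).
by rewrite eq eqxx in ne_ij.
Qed.

End IncidenceAlgebra.

(* Main.v *)
Require Import Defs.
From HB Require Import structures.
From mathcomp Require Import all_boot all_order all_algebra.
Set Implicit Arguments.
Unset Strict Implicit.
Unset Printing Implicit Defensive.
Import GRing.Theory.
Local Open Scope ring_scope.

(* The map [offdiag], which reads off the coordinates above the diagonal, is
   defined on all of End(U) and kills the diagonal, so it absorbs the projection
   in [odot].  Multiplicativity is then the bilinear identity
   offdiag (X Y + Y X) = offdiag X * offdiag Y on Sym0, which need only be
   checked on the generators S_ij by multiplying rank one maps. *)

(** Lets an identity that is linear in one argument be checked on a spanning family only. *)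
Lemma span_ind (K : fieldType) (V : vectType K) (s : seq V) (P : V -> Prop) :
  P 0 -> (forall a u w, P u -> P w -> P (a *: u + w)) ->
  {in s, forall u, P u} -> {in <<s>>%VS, forall u, P u}.
Proof.
move=> P0 PP Ps u su; rewrite (coord_span (X := in_tuple s) su).
apply: (big_ind P) => // [x y Px Py | i _].
  by rewrite -[x]scale1r; apply: PP.
by rewrite -[_ *: _]addr0; apply: PP => //; apply/Ps/mem_nth.
Qed.

Lemma outer_comp (K : fieldType) (U : vectType K) (form : {symmetric U})
    (a b c d : U) :
  (outer form a b \o outer form c d)%VF = form b c *: outer form a d.
Proof.
apply/lfunP=> x; rewrite comp_lfunE scale_lfunE !outerE Defs.formZr.
by rewrite scalerA mulrC.
Qed.

Lemma inc_mulPr (K : fieldType) (n : nat) a (x y z : inc_alg K n) :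
  inc_mul z (a *: x + y) = a *: inc_mul z x + inc_mul z y.
Proof. by rewrite inc_mulC inc_mulPl !(inc_mulC z). Qed.

Lemma inc_mul0l (K : fieldType) (n : nat) (z : inc_alg K n) : inc_mul 0 z = 0.
Proof.
(* Writing 0 as [-1 *: 0 + 0] gives the shape [inc_mulPl] needs; the two resulting terms cancel. *)
by rewrite -[X in inc_mul X _](addNr 0) -scaleN1r inc_mulPl scaleN1r addNr.
Qed.

Section OffDiagonal.

Variables (K : fieldType) (U : vectType K) (form : {symmetric U}).
Variables (n : nat) (v : n.-tuple U).
Local Notation "''v_' i" := (tnth v i) (at level 8, i at level 2).
Local Notation outer := (outer form).
Local Notation S := (Sij form v).
Local Notation jordan X Y := ((X \o Y) + (Y \o X))%VF.

Definition offdiag (X : 'End(U)) : inc_alg K n :=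
  \sum_(p : 'I_n * 'I_n | (p.1 < p.2)%N)
    form 'v_(p.1) (X 'v_(p.2)) *: inc_e K p.1 p.2.

Fact offdiag_is_linear : linear offdiag.
Proof.
move=> a X Y; rewrite /offdiag scaler_sumr -big_split.
apply: eq_bigr => p _ /=.
by rewrite add_lfunE scale_lfunE Defs.formPr scalerDl scalerA.
Qed.
HB.instance Definition _ :=
  GRing.isLinear.Build K 'End(U) (inc_alg K n) _ offdiag offdiag_is_linear.

Hypotheses (v_basis : basis_of fullv v) (v_on : orthonormal form v).

(** In the basis [v], the map $v_i v_j^T$ is a matrix unit, and [offdiag] sees its only entry
    exactly when it lies above the diagonal. *)
Lemma offdiag_outer i j :
  offdiag (outer 'v_i 'v_j) = if (i < j)%N then inc_e K i j else 0.
Proof.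
have coef p : form 'v_(p.1) (outer 'v_i 'v_j 'v_(p.2)) = (p == (i, j))%:R.
  rewrite outerE Defs.formZr !form_v // -natrM mulnb andbC (eq_sym j).
  by case: p.
rewrite /offdiag; under eq_bigr do rewrite coef.
case: ifP => ltij; last first.
  apply: big1 => p ltp; case: eqP => [eqp|]; last by rewrite scale0r.
  by rewrite eqp /= ltij in ltp.
rewrite (bigD1 (i, j)) //= eqxx scale1r big1 ?addr0 // => p /andP[_ /negPf->].
by rewrite scale0r.
Qed.

Lemma offdiag_Sij i j : i != j -> offdiag (S i j) = inc_e K i j.
Proof.
move=> ne_ij; rewrite linearD /= !offdiag_outer.
have [lt|gt|/val_inj eq] := ltngtP i j; first by rewrite addr0.
  by rewrite add0r inc_eC.
by rewrite eq eqxx in ne_ij.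
Qed.

Lemma offdiag_Diag : {in Diag form v, forall X, offdiag X = 0}.
Proof.
apply: span_ind => [|a X Y X0 Y0|_ /imageP[i _ ->]]; first exact: linear0.
  by rewrite linearP /= X0 Y0 scaler0 addr0.
by rewrite offdiag_outer ltnn.
Qed.

(** A self-adjoint map differs from its projection by its [Diag] component, which [offdiag]
    kills. *)
Lemma offdiag_proj X : offdiag (vsval (proj_diag form v X)) = offdiag (vsval X).
Proof.
have dX := Sym0_Diag_direct v_basis v_on.
have XS : vsval X \in (Sym0 form v + Diag form v)%VS.
  by rewrite (Sym_decomposition v_basis v_on) subvsP.
rewrite val_proj_diag -[in RHS](daddv_pi_add dX XS) linearD /=.
by rewrite [offdiag (daddv_pi (Diag _ _) _ _)]offdiag_Diag ?memv_pi ?addr0.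
Qed.

(** Of the eight rank one products only those contracting the shared $v_i$ survive: $v_j v_i^T v_i
    v_k^T$ and its transpose. The result is already off-diagonal. *)
Lemma jordan_Sij_adj i j k : i != j -> i != k -> j != k ->
  jordan (S i j) (S i k) = S j k.
Proof.
move=> ij ik jk.
rewrite /Sij !(comp_lfunDl, comp_lfunDr) !outer_comp !form_v // !eqxx.
rewrite (eq_sym j i) (eq_sym k i) (eq_sym k j).
by rewrite (negPf ij) (negPf ik) (negPf jk) !scale1r !scale0r !(addr0, add0r).
Qed.

Lemma jordan_Sij_disj i j k l : i != k -> i != l -> j != k -> j != l ->
  jordan (S i j) (S k l) = 0.
Proof.
move=> ik il jk jl.
rewrite /Sij !(comp_lfunDl, comp_lfunDr) !outer_comp !form_v //.
rewrite !(eq_sym k) !(eq_sym l).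
by rewrite (negPf ik) (negPf il) (negPf jk) (negPf jl) !scale0r !addr0.
Qed.

(** The square of $S_{ij}$ is $v_i v_i^T + v_j v_j^T$, which is diagonal; among products of
    generators, only here does the projection change anything. *)
Lemma offdiag_jordan_same i j : i != j -> offdiag (jordan (S i j) (S i j)) = 0.
Proof.
move=> ij; have ji : j != i by rewrite eq_sym.
rewrite /Sij !(comp_lfunDl, comp_lfunDr) !outer_comp !form_v // !eqxx.
rewrite (negPf ij) (negPf ji) !scale0r !scale1r !(addr0, add0r).
by rewrite !linearD /= !offdiag_outer !ltnn !addr0.
Qed.

Lemma offdiag_jordan_Sij i j k l : i != j -> k != l ->
  offdiag (jordan (S i j) (S k l)) = inc_mul (inc_e K i j) (inc_e K k l).
Proof.
move=> ij kl.
(* Two edges with a common point, possibly equal: the symmetries of [S] and [inc_e] bring any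
   coincidence of indices to this form. *)
have shared a b c : a != b -> a != c ->
    offdiag (jordan (S a b) (S a c)) = inc_mul (inc_e K a b) (inc_e K a c).
  move=> ab ac; have [<-|bc] := eqVneq b c.
    by rewrite offdiag_jordan_same // inc_mul_same.
  by rewrite jordan_Sij_adj // offdiag_Sij // inc_mul_adj.
have [eq_ik|ik] := eqVneq i k; first by rewrite -eq_ik in kl *; apply: shared.
have [eq_il|il] := eqVneq i l.
  by rewrite -eq_il in kl *; rewrite (SijC _ _ k) (inc_eC K k) shared // eq_sym.
have [eq_jk|jk] := eqVneq j k.
  by rewrite -eq_jk in kl *; rewrite (SijC _ _ i) (inc_eC K i) shared // eq_sym.
have [eq_jl|jl] := eqVneq j l.
  rewrite -eq_jl in kl *; rewrite (SijC _ _ i) (SijC _ _ k) (inc_eC K i).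
  by rewrite (inc_eC K k) shared // eq_sym.
rewrite jordan_Sij_disj // linear0 inc_mul_disj //.
rewrite disjoints_subset; apply/subsetP=> x; rewrite !inE.
by case/orP=> /eqP->; rewrite negb_or ?ik ?il ?jk ?jl.
Qed.

Lemma offdiag_jordan :
  {in Sym0 form v &, forall X Y,
     offdiag (jordan X Y) = inc_mul (offdiag X) (offdiag Y)}.
Proof.
have ne_lt (i j : 'I_n) : (i < j)%N -> i != j.
  by move=> lt; rewrite -val_eqE /= (ltn_eqF lt).
(* Reduce [Y] to a generator with [X] fixed, then reduce [X]. *)
move=> X Y X0; move: Y; apply: span_ind => [|a Y Z IHY IHZ|Y].
- by rewrite comp_lfun0l comp_lfun0r addr0 linear0 inc_mulC inc_mul0l.
- rewrite linearP /= inc_mulPr -IHY -IHZ -linearP; congr offdiag.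
  by rewrite comp_lfunDl comp_lfunDr -comp_lfunZl -comp_lfunZr scalerDr addrACA.
case/imageP=> -[k l] /= ltkl ->; move: X X0.
apply: span_ind => [|a X Z IHX IHZ|X].
- by rewrite comp_lfun0l comp_lfun0r addr0 linear0 inc_mul0l.
- rewrite linearP /= inc_mulPl -IHX -IHZ -linearP; congr offdiag.
  (* [S k l] must be opaque here, else [comp_lfunDr] unfolds it. *)
  move: (S k l) => W.
  by rewrite comp_lfunDl comp_lfunDr -comp_lfunZl -comp_lfunZr scalerDr addrACA.
case/imageP=> -[i j] /= ltij ->.
by rewrite offdiag_jordan_Sij ?offdiag_Sij ?ne_lt.
Qed.

Definition Sym0_to_inc : 'Hom(subvs_of (Sym0 form v), inc_alg K n) :=
  linfun (offdiag \o vsval).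

Lemma Sym0_to_incE X : Sym0_to_inc X = offdiag (vsval X).
Proof. by rewrite lfunE. Qed.

Lemma Sym0_to_inc_Sij i j (ne_ij : i != j) :
  Sym0_to_inc (Sij0 form v ne_ij) = inc_e K i j.
Proof. by rewrite Sym0_to_incE offdiag_Sij. Qed.

(** The images of the $S_{ij}$ with $i<j$ already form a basis of the target. *)
Lemma limg_Sym0_to_inc : limg Sym0_to_inc = fullv.
Proof.
apply/eqP; rewrite eqEsubv subvf -(span_basis (inc_e_basis K n)).
apply/span_subvP=> _ /imageP[[i j] /= ltij ->].
have ne_ij : i != j by rewrite -val_eqE /= (ltn_eqF ltij).
by rewrite -(Sym0_to_inc_Sij ne_ij) memv_img ?memvf.
Qed.

(* Sym0 is spanned by as many elements as inc_alg has dimensions, so the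
   surjection is injective. *)
Lemma Sym0_to_inc_bij : bijective Sym0_to_inc.
Proof.
have ker0 : lker Sym0_to_inc == 0%VS.
  have := limg_ker_dim Sym0_to_inc fullv.
  rewrite limg_Sym0_to_inc capfv (size_basis (inc_e_basis K n)) => dimE.
  rewrite -dimv_eq0 -leqn0
    -(leq_add2r #|[pred p : 'I_n * 'I_n | (p.1 < p.2)%N]|).
  by rewrite dimE dimvf (leq_trans (dim_span _)) // size_image.
exists (Sym0_to_inc^-1)%VF => x; first exact: lker0_lfunK.
by rewrite limg_lfunVK // limg_Sym0_to_inc memvf.
Qed.

End OffDiagonal.

Theorem proposition3p1
  (K : fieldType) (K_real : formally_real K) (K_pyth : pythagorean K)
  (n : nat) (n_ge2 : (2 <= n)%N)
  (U : vectType K) (form : {symmetric U}) (U_eucl : euclidean form)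
  (dimU : \dim {: U} = n)
  (v : n.-tuple U)
  (v_basis : basis_of fullv v) (v_orthonormal : orthonormal form v) :
  exists phi : 'Hom(subvs_of (Sym0 form v), inc_alg K n),
    [/\ forall (i j : 'I_n) (ne_ij : i != j),
          phi (Sij0 form v ne_ij) = inc_e K i j,
        bijective phi
      & forall X Y, phi (odot X Y) = inc_mul (phi X) (phi Y)].
Proof.
exists (Sym0_to_inc form v); split=> [i j ne_ij||X Y].
- exact: Sym0_to_inc_Sij.
- exact: Sym0_to_inc_bij.
(* [odot] unfolds to [proj_diag] of the Jordan product, so [offdiag_proj] removes the projection. *)
by rewrite !Sym0_to_incE offdiag_proj // offdiag_jordan ?subvsP.
Qed.
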